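(* Let $\mathbf{P}\subset\mathbb{S}^{n_z+n_w}$ be a multiplier set for $\mathbf{\Delta}$, and let $$\mathbf{P}_{\mathcal D}:=\{\,q\,W^\top W : q\in\mathbb{R}\,\},\qquad W:=\begin{pmatrix} y_\ast \\ x_\ast \\ r_\ast\end{pmatrix}^{\!\top}\begin{pmatrix} 0&I \\ -\hat C_{hz}^\top&-\hat C_{hy}^\top \\ -\hat D_{hzr}^\top&-\hat D_{hyr}^\top\end{pmatrix}\in\mathbb{R}^{1\times(hn_z+hn_y)}.$$ Suppose that $\sigma\in\{1,\dots,h\}$ is such that $$\ker(\hat D_{hyw})\subset\ker\begin{pmatrix}\hat B_{\sigma w}&0_{n\times(h-\sigma)n_w}\end{pmatrix},$$ and define, with $\hat D_{hyw}^+$ denoting the Moore-Penrose pseudoinverse of $\hat D_{hyw}$, $$M:=\begin{pmatrix}\hat B_{\sigma w}&0_{n\times(h-\sigma)n_w}\end{pmatrix}\hat D_{hyw}^+\in\mathbb{R}^{n\times hn_y},\qquad N:=\begin{pmatrix} I_{\sigma n_z}&0\end{pmatrix}\in\mathbb{R}^{\sigma n_z\times hn_z}.$$ Then the feedback interconnection $$\begin{pmatrix} x(k+1) \\ z(k) \\ y(k)\end{pmatrix}=\begin{pmatrix} A&B_w&B_r \\ C_z&D_{zw}&D_{zr} \\ C_y&D_{yw}&D_{yr}\end{pmatrix}\begin{pmatrix} x(k) \\ w(k) \\ r(k)\end{pmatrix},\qquad w(k)=\Delta_\ast z(k),$$ is stable if there exist matrices $X\in\mathbb{S}^n$ with $X\succ0$,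 $P=\begin{pmatrix} Q&S \\ S^\top&R\end{pmatrix}\in\mathbf{P}$ (with $Q\in\mathbb{S}^{n_z}$, $R\in\mathbb{S}^{n_w}$) and $P_{\mathcal D}\in\mathbf{P}_{\mathcal D}$ satisfying, with $\hat P:=\begin{pmatrix} I_\sigma\otimes Q&I_\sigma\otimes S \\ I_\sigma\otimes S^\top&I_\sigma\otimes R\end{pmatrix}$, $$G^\top\,\mathrm{diag}(X,\,-X,\,\hat P,\,P_{\mathcal D})\,G\succ0,\qquad G:=\begin{pmatrix} I&0 \\ -(A^\sigma)^\top&-\hat C_{\sigma z}^\top \\ 0&I \\ -\hat B_{\sigma w}^\top&-\hat D_{\sigma zw}^\top \\ 0&N^\top \\ M^\top&0\end{pmatrix}.$$
   Context: $\mathbb{S}^m$ denotes the set of real symmetric $m\times m$ matrices, $\otimes$ is the Kronecker product, and $\succ0$, $\preccurlyeq0$ denote positive definiteness and negative semidefiniteness. System. The matrices $A,B_w,B_r,C_z,D_{zw},D_{zr},C_y,D_{yw},D_{yr}$ are real of compatible dimensions, with signals $x(k)\in\mathbb{R}^n$, $w(k)\in\mathbb{R}^{n_w}$, $z(k)\in\mathbb{R}^{n_z}$, $r(k)\in\mathbb{R}^{n_r}$, $y(k)\in\mathbb{R}^{n_y}$. The constant matrix $\Delta_\ast\in\mathbb{R}^{n_w\times n_z}$ is unknown, but belongs to a given set $\mathbf{\Delta}\subset\mathbb{R}^{n_w\times n_z}$. Stability. The interconnection is called stable if $I-D_{zw}\Delta_\ast$ is nonsingular and there exist $K,\gamma>0$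 such that $\|x(t)\|\le Ke^{-\gamma t}\|x(0)\|$ for all $t\ge0$, all $x(0)\in\mathbb{R}^n$ and for $r=0$. Multiplier set. A set $\mathbf{P}\subset\mathbb{S}^{n_z+n_w}$ is called a (dual) multiplier set for $\mathbf{\Delta}\subset\mathbb{R}^{n_w\times n_z}$ if $$\begin{pmatrix} -\Delta^\top \\ I\end{pmatrix}^{\!\top}P\begin{pmatrix} -\Delta^\top \\ I\end{pmatrix}\preccurlyeq0\quad\text{for all }(\Delta,P)\in\mathbf{\Delta}\times\mathbf{P}$$ and if $\mathbf{P}$ admits an LMI representation, i.e., there exist affine (symmetric) matrix-valued maps $E,F$ on some $\mathbb{R}^p$ with $\mathbf{P}=\{E(\nu):\nu\in\mathbb{R}^p,\ F(\nu)\succ0\}$. Data. $h\ge1$ is a given horizon length and $(x_\ast,r_\ast,y_\ast)\in\mathbb{R}^n\times\mathbb{R}^{hn_r}\times\mathbb{R}^{hn_y}$ is a given input-output trajectory generated by the interconnection: $r_\ast$ and $y_\ast$ are the vertically stacked vectors of $r_\ast(0),\dots,r_\ast(h-1)$ and $y_\ast(0),\dots,y_\ast(h-1)$, and there exist signals $x,w,z$ satisfying the interconnection equations (with the true $\Delta_\ast$) for $k=0,\dots,h-1$ with $x(0)=x_\ast$, $r(k)=r_\ast(k)$, $y(k)=y_\ast(k)$. Lifted matrices. For every integer $k\ge1$, $i\in\{w,r\}$ and $o\in\{z,y\}$, $$\hat B_{ki}:=\begin{pmatrix} A^{k-1}B_i&A^{k-2}B_i&\cdots&B_i\end{pmatrix},\qquad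 \hat C_{ko}:=\begin{pmatrix} C_o \\ C_oA \\ \vdots \\ C_oA^{k-1}\end{pmatrix},$$ $$\hat D_{koi}:=\begin{pmatrix} D_{oi}&0&\cdots&0 \\ C_oB_i&D_{oi}&\ddots&\vdots \\ \vdots&\ddots&\ddots&0 \\ C_oA^{k-2}B_i&\cdots&C_oB_i&D_{oi}\end{pmatrix}$$ ($k\times k$ blocks). *)

(* Defs.v *)
From HB Require Import structures.
From mathcomp Require Export all_boot all_order all_algebra.
From mathcomp Require Export boolp classical_sets reals sequences exp.
From mathcomp Require Export mxtens.

Set Implicit Arguments.
Unset Strict Implicit.
Unset Printing Implicit Defensive.

Import Order.TTheory GRing.Theory Num.Theory.

Local Open Scope classical_set_scope.
Local Open Scope ring_scope.

Section Matrices.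
Context {R : realType}.

Lemma symmetricmxP n (A : 'M[R]_n) : reflect (A^T = A) (A \is symmetricmx).
Proof.
rewrite qualifE /= expr0 scale1r map_mx_id //.
by apply: (iffP eqP) => /esym.
Qed.

Definition posdefmx n (A : 'M[R]_n) : Prop :=
  A \is symmetricmx /\
  forall v : 'cV[R]_n, v != 0 -> 0 < (v^T *m A *m v) 0 0.

Definition negsemidefmx n (A : 'M[R]_n) : Prop :=
  A \is symmetricmx /\
  forall v : 'cV[R]_n, (v^T *m A *m v) 0 0 <= 0.

(* The norm [`|v|] that the library puts on matrices is the sup norm. *)
Definition enorm n (v : 'cV[R]_n) : R := Num.sqrt (\sum_i v i 0 ^+ 2).

Definition penrose m n (A : 'M[R]_(m, n)) (X : 'M[R]_(n, m)) : Prop :=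
  [/\ A *m X *m A = A, X *m A *m X = X,
      (A *m X)^T = A *m X & (X *m A)^T = X *m A].

(* Moore-Penrose pseudoinverse; the library's [pinvmx] only satisfies the
   first Penrose equation. *)
Definition mpinv m n (A : 'M[R]_(m, n)) : 'M[R]_(n, m) :=
  xget 0 [set X | penrose A X].

Lemma gram_unit m n (A : 'M[R]_(m, n)) : row_free A -> A *m A^T \in unitmx.
Proof.
move=> fA; rewrite -row_free_unit -kermx_eq0; apply/rowV0P => v /sub_kermxP vAA.
have vA0 : v *m A = 0.
  have : \sum_j (v *m A) 0 j ^+ 2 = 0.
    transitivity ((v *m A *m (v *m A)^T) 0 0).
      by rewrite [RHS]mxE; apply: eq_bigr => j _; rewrite [_^T _ _]mxE.
    by rewrite trmx_mul !mulmxA -(mulmxA v) vAA mul0mx mxE.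
  move=> /eqP; rewrite psumr_eq0; last by move=> j _; exact: sqr_ge0.
  move=> /allP vA0; apply/rowP => j; rewrite [RHS]mxE; apply/eqP.
  by rewrite -sqrf_eq0; apply: vA0; rewrite mem_index_enum.
by apply: (row_free_inj fA); rewrite vA0 mul0mx.
Qed.

Lemma penrose_factor m n r (F : 'M[R]_(m, r)) (G : 'M[R]_(r, n)) :
  F^T *m F \in unitmx -> G *m G^T \in unitmx ->
  penrose (F *m G) (G^T *m invmx (G *m G^T) *m (invmx (F^T *m F) *m F^T)).
Proof.
move=> uF uG; set H := invmx (G *m G^T); set K := invmx (F^T *m F).
have HT : H^T = H by rewrite /H trmx_inv trmx_mul trmxK.
have KT : K^T = K by rewrite /K trmx_inv trmx_mul trmxK.
have GH : G *m G^T *m H = 1%:M by rewrite mulmxV.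
have KF : K *m (F^T *m F) = 1%:M by rewrite mulVmx.
pose X := G^T *m H *m (K *m F^T); rewrite -/X.
have AX : F *m G *m X = F *m K *m F^T.
  transitivity (F *m (G *m G^T *m H) *m (K *m F^T)); first by rewrite /X !mulmxA.
  by rewrite GH mulmx1 mulmxA.
have XA : X *m (F *m G) = G^T *m H *m G.
  transitivity (G^T *m H *m (K *m (F^T *m F)) *m G); first by rewrite /X !mulmxA.
  by rewrite KF mulmx1.
split.
- rewrite AX; transitivity (F *m (K *m (F^T *m F)) *m G).
    by rewrite !mulmxA.
  by rewrite KF mulmx1.
- rewrite XA /X; transitivity (G^T *m H *m (G *m G^T *m H) *m (K *m F^T)).
    by rewrite !mulmxA.
  by rewrite GH mulmx1.
- by rewrite AX !trmx_mul trmxK KT mulmxA.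
- by rewrite XA !trmx_mul trmxK HT mulmxA.
Qed.

Lemma penrose_exists m n (A : 'M[R]_(m, n)) : exists X, penrose A X.
Proof.
rewrite -(mulmx_base A); eexists; apply: penrose_factor; last first.
  by apply: gram_unit; exact: row_base_free.
have := @gram_unit _ _ (col_base A)^T; rewrite trmxK; apply.
by rewrite /row_free mxrank_tr; exact: col_base_full.
Qed.

Lemma mpinvP m n (A : 'M[R]_(m, n)) : penrose A (mpinv A).
Proof. by have [X AX] := penrose_exists A; exact: (xgetPex 0 (ex_intro _ X AX)). Qed.

Lemma penrose_uniq m n (A : 'M[R]_(m, n)) X Y :
  penrose A X -> penrose A Y -> X = Y.
Proof.
move=> [AXA XAX AXT XAT] [AYA YAY AYT YAT].
have XE : A *m X = A *m Y.
  rewrite -AXT -{1}AYA -(mulmxA (A *m Y)) trmx_mul AXT AYT.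
  by rewrite mulmxA AXA.
have YE : X *m A = Y *m A.
  rewrite -XAT -{1}AYA -(mulmxA A) mulmxA trmx_mul XAT YAT.
  by rewrite -!mulmxA (mulmxA A) AXA.
by rewrite -XAX -YAY YE -!mulmxA XE.
Qed.

Definition affine_sym p m (E : 'cV[R]_p -> 'M[R]_m) : Prop :=
  (exists (c : 'M[R]_m) (L : {linear 'cV[R]_p -> 'M[R]_m}),
     forall nu, E nu = c + L nu) /\
  (forall nu, E nu \is symmetricmx).

Definition lmi_representable m (P : set 'M[R]_m) : Prop :=
  exists (p k : nat) (E : 'cV[R]_p -> 'M[R]_m) (F : 'cV[R]_p -> 'M[R]_k),
    [/\ affine_sym E, affine_sym F &
        P = [set E nu | nu in [set nu | posdefmx (F nu)]]].

Definition multiplier_set nw nz (Delta : set 'M[R]_(nw, nz))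
    (P : set 'M[R]_(nz + nw)) : Prop :=
  [/\ forall Q, P Q -> Q \is symmetricmx,
      forall (D : 'M[R]_(nw, nz)) (Q : 'M[R]_(nz + nw)), Delta D -> P Q ->
        negsemidefmx ((col_mx (- D^T) 1%:M)^T *m Q *m col_mx (- D^T) 1%:M) &
      lmi_representable P].

Definition block_diag m n (A : 'M[R]_m) (B : 'M[R]_n) : 'M[R]_(m + n) :=
  block_mx A 0 0 B.

Definition stack h m (s : nat -> 'cV[R]_m) : 'cV[R]_(h * m) :=
  \col_i s (mxtens_unindex i).1 (mxtens_unindex i).2 0.

Lemma stack_dimE s h m : (s <= h)%N -> (s * m + (h - s) * m = h * m)%N.
Proof. by move=> sh; rewrite -mulnDl subnKC. Qed.

(* (B 0): pads B, made of s block columns of width m, with h - s zero blocks. *)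
Definition pad_row s h m n (sh : (s <= h)%N) (B : 'M[R]_(n, s * m)) :
    'M[R]_(n, h * m) :=
  castmx (erefl n, stack_dimE m sh) (row_mx B (0 : 'M_(n, (h - s) * m))).

(* The lifted matrices. Indices along 'I_(k * m) are split into a block number
   (first component) and a position in the block (second component). *)
Definition lift_B k n m (A : 'M[R]_n) (B : 'M[R]_(n, m)) : 'M[R]_(n, k * m) :=
  \matrix_(i, j)
    (A ^+ (k - 1 - (mxtens_unindex j).1) *m B) i (mxtens_unindex j).2.

Definition lift_C k n m (A : 'M[R]_n) (C : 'M[R]_(m, n)) : 'M[R]_(k * m, n) :=
  \matrix_(i, j)
    (C *m A ^+ (mxtens_unindex i).1) (mxtens_unindex i).2 j.

Definition markov n p q (A : 'M[R]_n) (B : 'M[R]_(n, q)) (C : 'M[R]_(p, n))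
    (D : 'M[R]_(p, q)) (i j : nat) : 'M[R]_(p, q) :=
  if i == j then D
  else if (j < i)%N then C *m A ^+ (i - j - 1) *m B
  else 0.

Definition lift_D k n p q (A : 'M[R]_n) (B : 'M[R]_(n, q)) (C : 'M[R]_(p, n))
    (D : 'M[R]_(p, q)) : 'M[R]_(k * p, k * q) :=
  \matrix_(i, j)
    markov A B C D (mxtens_unindex i).1 (mxtens_unindex j).1
      (mxtens_unindex i).2 (mxtens_unindex j).2.

End Matrices.

Record plant (R : realType) (n nw nr nz ny : nat) := Plant {
  pA : 'M[R]_n;        pBw : 'M[R]_(n, nw);   pBr : 'M[R]_(n, nr);
  pCz : 'M[R]_(nz, n); pDzw : 'M[R]_(nz, nw); pDzr : 'M[R]_(nz, nr);
  pCy : 'M[R]_(ny, n); pDyw : 'M[R]_(ny, nw); pDyr : 'M[R]_(ny, nr)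
}.

Section Plant.
Context {R : realType} {n nw nr nz ny : nat}.
Variable G : plant R n nw nr nz ny.

Definition interconnection (Delta : 'M[R]_(nw, nz)) (x : nat -> 'cV[R]_n)
    (w : nat -> 'cV[R]_nw) (z : nat -> 'cV[R]_nz) (r : nat -> 'cV[R]_nr)
    (y : nat -> 'cV[R]_ny) (k : nat) : Prop :=
  [/\ x k.+1 = pA G *m x k + pBw G *m w k + pBr G *m r k,
      z k = pCz G *m x k + pDzw G *m w k + pDzr G *m r k,
      y k = pCy G *m x k + pDyw G *m w k + pDyr G *m r k &
      w k = Delta *m z k].

(* All signals driven by r = 0 are considered, so that x 0 is arbitrary. *)
Definition stable (Delta : 'M[R]_(nw, nz)) : Prop :=
  1%:M - pDzw G *m Delta \in unitmx /\
  exists K gamma : R, [/\ 0 < K, 0 < gamma &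
    forall x w z y,
      (forall k, interconnection Delta x w z (fun=> 0) y k) ->
      forall t : nat,
        enorm (x t) <= K * expR (- gamma * t%:R) * enorm (x 0%N)].

(* Signals are functions on nat, but only the instants k < h (and, for the
   state, k <= h) are constrained. *)
Definition io_trajectory (Delta : 'M[R]_(nw, nz)) h (xs : 'cV[R]_n)
    (rs : 'cV[R]_(h * nr)) (ys : 'cV[R]_(h * ny)) : Prop :=
  exists x w z r y,
    [/\ forall k, (k < h)%N -> interconnection Delta x w z r y k,
        x 0%N = xs, stack h r = rs & stack h y = ys].

Definition hatBw k := lift_B k (pA G) (pBw G).
Definition hatBr k := lift_B k (pA G) (pBr G).
Definition hatCz k := lift_C k (pA G) (pCz G).
Definition hatCy k := lift_C k (pA G) (pCy G).
Definition hatDzw k := lift_D k (pA G) (pBw G) (pCz G) (pDzw G).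
Definition hatDzr k := lift_D k (pA G) (pBr G) (pCz G) (pDzr G).
Definition hatDyw k := lift_D k (pA G) (pBw G) (pCy G) (pDyw G).
Definition hatDyr k := lift_D k (pA G) (pBr G) (pCy G) (pDyr G).

Definition data_W h (xs : 'cV[R]_n) (rs : 'cV[R]_(h * nr))
    (ys : 'cV[R]_(h * ny)) : 'M[R]_(1, h * nz + h * ny) :=
  (col_mx ys (col_mx xs rs))^T *m
  col_mx (row_mx 0 1%:M)
    (col_mx (row_mx (- (hatCz h)^T) (- (hatCy h)^T))
            (row_mx (- (hatDzr h)^T) (- (hatDyr h)^T))).

Definition data_multipliers h xs rs ys : set 'M[R]_(h * nz + h * ny) :=
  [set q *: ((data_W xs rs ys)^T *m data_W xs rs ys) | q in [set: R]].

Definition mx_M s h (sh : (s <= h)%N) : 'M[R]_(n, h * ny) :=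
  pad_row sh (hatBw s) *m mpinv (hatDyw h).

Definition mx_N s h (sh : (s <= h)%N) : 'M[R]_(s * nz, h * nz) :=
  pad_row sh 1%:M.

Definition lift_multiplier s (Q : 'M[R]_nz) (S : 'M[R]_(nz, nw))
    (T : 'M[R]_nw) : 'M[R]_(s * nz + s * nw) :=
  block_mx ((1%:M : 'M_s) *t Q) ((1%:M : 'M_s) *t S)
           ((1%:M : 'M_s) *t S^T) ((1%:M : 'M_s) *t T).

Definition outer_G s h (sh : (s <= h)%N) :
    'M[R]_(n + (n + ((s * nz + s * nw) + (h * nz + h * ny))), n + s * nz) :=
  col_mx (row_mx 1%:M 0)
 (col_mx (row_mx (- (pA G ^+ s)^T) (- (hatCz s)^T))
 (col_mx (col_mx (row_mx 0 1%:M)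
                 (row_mx (- (hatBw s)^T) (- (hatDzw s)^T)))
         (col_mx (row_mx 0 (mx_N sh)^T)
                 (row_mx (mx_M sh)^T 0)))).

End Plant.

(* Main.v *)
Require Import Defs.
From mathcomp Require Import ring lra.

(** The matrix inequality is a dual (co-state) certificate for the
    interconnection observed every [s] steps. Write [Dhat] for the block diagonal
    uncertainty [1 (x) Delta], hats for lifted matrices, and let [Phi] be the
    [s]-th power of the closed-loop state matrix. The quadratic form of the
    inequality is evaluated at [(xi, eta)] where [eta] solves the adjoint loop
    equation [eta = Dhat^T (Bhat^T xi + Dzwhat^T eta)].

    - The multiplier term is then a sum of [s] values of the form of [P] on the
      graph of [- Delta^T], hence nonpositive ([lift_multiplier_le0]).
    - The data term vanishes. By the kernel inclusion and the lifted equations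
      of the recorded trajectory, [W] applied to [(N^T eta, M^T xi)] is
      [(xi, Bhat w) - (eta, z - Dzwhat w)] ([data_annihilator]), and the adjoint
      equation together with [w = Dhat z] makes this zero. This is why the
      factor [q] of the data multiplier may have any sign.
    - What remains is [(p, X p) < (xi, X xi)] with
      [p = (A^s)^T xi + Czhat^T eta] ([lifted_stein_ineq]).

    At [xi = 0] the last inequality is impossible for [eta] nonzero. Thus the
    adjoint loop is injective; this shows that [1 - Dzw Delta] is invertible
    ([loop_unit]) and that every [xi] has its [eta] ([lifted_loop_solve]).
    Pairing with closed-loop trajectories identifies [p] with [Phi^T xi]
    ([closed_loop_stein]), so that [X - Phi X Phi^T] is positive definite. Such
    a Stein inequality forces geometric decay of the powers of [Phi]
    ([stein_decay]), and the gaps between the multiples of [s] only cost a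
    constant ([sampled_decay]). *)

Set Implicit Arguments.
Unset Strict Implicit.
Unset Printing Implicit Defensive.

Import Order.TTheory GRing.Theory Num.Theory.

Local Open Scope classical_set_scope.
Local Open Scope ring_scope.

(** * Euclidean product and positive definite forms *)

Section Dot.
Context {R : realType}.

Definition dot n (u v : 'cV[R]_n) : R := (u^T *m v) 0 0.

Lemma dotE n (u v : 'cV[R]_n) : dot u v = \sum_i u i 0 * v i 0.
Proof. by rewrite /dot mxE; apply: eq_bigr => i _; rewrite mxE. Qed.

Lemma dotC n (u v : 'cV[R]_n) : dot u v = dot v u.
Proof. by rewrite !dotE; apply: eq_bigr => i _; rewrite mulrC. Qed.

Lemma dotDr n (u v w : 'cV[R]_n) : dot u (v + w) = dot u v + dot u w.
Proof. by rewrite /dot mulmxDr mxE. Qed.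

Lemma dotNr n (u v : 'cV[R]_n) : dot u (- v) = - dot u v.
Proof. by rewrite /dot mulmxN mxE. Qed.

Lemma dotZr n (u v : 'cV[R]_n) a : dot u (a *: v) = a * dot u v.
Proof. by rewrite /dot -scalemxAr mxE. Qed.

Lemma dotDl n (u v w : 'cV[R]_n) : dot (u + v) w = dot u w + dot v w.
Proof. by rewrite dotC dotDr !(dotC w). Qed.

Lemma dotNl n (u v : 'cV[R]_n) : dot (- u) v = - dot u v.
Proof. by rewrite dotC dotNr dotC. Qed.

Lemma dotZl n (u v : 'cV[R]_n) a : dot (a *: u) v = a * dot u v.
Proof. by rewrite dotC dotZr dotC. Qed.

Lemma dot0r n (u : 'cV[R]_n) : dot u 0 = 0.
Proof. by rewrite /dot mulmx0 mxE. Qed.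

Lemma dot0l n (u : 'cV[R]_n) : dot 0 u = 0.
Proof. by rewrite dotC dot0r. Qed.

Lemma dot_mull m n (A : 'M[R]_(m, n)) u v : dot (A *m u) v = dot u (A^T *m v).
Proof. by rewrite /dot trmx_mul mulmxA. Qed.

Lemma dot_mulr m n (A : 'M[R]_(m, n)) u v : dot u (A *m v) = dot (A^T *m u) v.
Proof. by rewrite dot_mull trmxK. Qed.

Lemma dot_col_mx m n (u u' : 'cV[R]_m) (v v' : 'cV[R]_n) :
  dot (col_mx u v) (col_mx u' v') = dot u u' + dot v v'.
Proof. by rewrite /dot tr_col_mx mul_row_col mxE. Qed.

Lemma dot_ge0 n (v : 'cV[R]_n) : 0 <= dot v v.
Proof. by rewrite dotE sumr_ge0 // => i _; rewrite -expr2 sqr_ge0. Qed.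

Lemma dot_gt0 n (v : 'cV[R]_n) : v != 0 -> 0 < dot v v.
Proof.
move=> v0; rewrite lt_neqAle dot_ge0 andbT eq_sym; apply: contra v0.
rewrite dotE psumr_eq0; last by move=> i _; rewrite -expr2 sqr_ge0.
move=> /allP vi; apply/eqP/colP => i; rewrite [RHS]mxE; apply/eqP.
by rewrite -sqrf_eq0 expr2; apply: vi; rewrite mem_index_enum.
Qed.

Lemma dot_inj n (u v : 'cV[R]_n) : (forall w, dot u w = dot v w) -> u = v.
Proof.
move=> uv; apply/eqP; rewrite -subr_eq0; apply/negPn/negP => /dot_gt0.
by rewrite dotDl dotNl uv subrr ltxx.
Qed.

Lemma posdefmx1 n : posdefmx (1%:M : 'M[R]_n).
Proof.
split; first by apply/symmetricmxP; rewrite trmx1.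
by move=> v v0; rewrite mulmx1 dot_gt0.
Qed.

Lemma posdefmx_gt0 n (X : 'M[R]_n) v :
  posdefmx X -> v != 0 -> 0 < dot v (X *m v).
Proof. by move=> [_ X0] /X0; rewrite -mulmxA. Qed.

Lemma posdefmx_ge0 n (X : 'M[R]_n) v : posdefmx X -> 0 <= dot v (X *m v).
Proof.
move=> X0; have [->|v0] := eqVneq v 0; first by rewrite dot0l.
by rewrite ltW // posdefmx_gt0.
Qed.

(** The form is nonnegative at [(v, X v) u - (u, X v) v], where it equals
    [(v, X v)] times the gap of the inequality. *)
Lemma cauchy_schwarz_posdefmx n (X : 'M[R]_n) u v : posdefmx X ->
  dot u (X *m v) ^+ 2 <= dot u (X *m u) * dot v (X *m v).
Proof.
move=> X0; have [->|v0] := eqVneq v 0.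
  by rewrite mulmx0 dot0r dot0l expr0n mulr0.
have XT : X^T = X by apply/symmetricmxP; case: X0.
have := posdefmx_gt0 X0 v0.
have := posdefmx_ge0 (dot v (X *m v) *: u - dot u (X *m v) *: v) X0.
rewrite mulmxDr mulmxN -!scalemxAr !(dotDl, dotDr, dotNl, dotNr, dotZl, dotZr).
have -> : dot v (X *m u) = dot u (X *m v) by rewrite dot_mulr XT dotC.
set a := dot u (X *m u); set b := dot u _; set c := dot v _ => ge0 c0.
have {}ge0 : 0 <= c * (a * c - b ^+ 2) by move: ge0; congr (0 <= _); ring.
by rewrite -subr_ge0 -(pmulr_rge0 _ c0).
Qed.

Lemma cauchy_schwarz n (u v : 'cV[R]_n) : dot u v ^+ 2 <= dot u u * dot v v.
Proof.
by have := cauchy_schwarz_posdefmx u v (posdefmx1 n); rewrite !mul1mx.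
Qed.

Lemma mulmx_bound m n (A : 'M[R]_(m, n)) : exists2 c, 1 <= c &
  forall v, dot (A *m v) (A *m v) <= c * dot v v.
Proof.
exists (1 + \sum_i dot (row i A)^T (row i A)^T).
  by rewrite lerDl sumr_ge0 // => i _; exact: dot_ge0.
move=> v; rewrite mulrDl mul1r mulr_suml -[leLHS]add0r lerD ?dot_ge0 //.
rewrite dotE ler_sum // => i _; rewrite -expr2.
have -> : (A *m v) i 0 = dot (row i A)^T v.
  by rewrite dotE mxE; apply: eq_bigr => j _; rewrite !mxE.
exact: cauchy_schwarz.
Qed.

(** Since [2 (v, A v) <= (v, v) + (A v, A v)], a gain of [A] also bounds its
    quadratic form. *)
Lemma form_bound n (A : 'M[R]_n) : exists2 c, 0 < c &
  forall v, dot v (A *m v) <= c * dot v v.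
Proof.
have [c c1 Ac] := mulmx_bound A; exists (1 + c); first lra.
move=> v; have := dot_ge0 (v - A *m v); have := Ac v.
have := dot_ge0 v; have := dot_ge0 (A *m v).
rewrite !(dotDl, dotDr, dotNl, dotNr) (dotC (A *m v) v); nra.
Qed.

Lemma posdefmx_unit n (X : 'M[R]_n) : posdefmx X -> X \in unitmx.
Proof.
move=> X0; rewrite -row_free_unit -kermx_eq0; apply/rowV0P => v /sub_kermxP vX.
apply/eqP/negPn/negP => v0; have XT : X^T = X by apply/symmetricmxP; case: X0.
have : v^T != 0 by rewrite -(inj_eq trmx_inj) trmxK trmx0.
by move=> /(posdefmx_gt0 X0); rewrite -XT -trmx_mul vX trmx0 dot0r ltxx.
Qed.

(** Cauchy-Schwarz for the form [X] at [v] and [X^-1 v] gives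
    [(v, v)^2 <= (v, X v) (v, X^-1 v)], and the second factor is at most a
    multiple of [(v, v)]. *)
Lemma posdefmx_coercive n (X : 'M[R]_n) : posdefmx X ->
  exists2 c, 0 < c & forall v, c * dot v v <= dot v (X *m v).
Proof.
move=> X0; have XT : X^T = X by apply/symmetricmxP; case: X0.
have [c c0 cX] := form_bound (invmx X).
exists c^-1; first by rewrite invr_gt0.
move=> v; have [->|v0] := eqVneq v 0; first by rewrite !dot0l mulr0.
have := cauchy_schwarz_posdefmx v (invmx X *m v) X0.
rewrite mulKVmx ?posdefmx_unit // (dotC (invmx X *m v)).
have := cX v; have := posdefmx_gt0 X0 v0; have := dot_gt0 v0.
set a := dot v v; set b := dot v (X *m v); set d := dot v _ => a0 b0 dc ab.
rewrite mulrC ler_pdivrMr // -(ler_pM2r a0) -expr2.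
by rewrite (le_trans ab) // -mulrA ler_pM2l.
Qed.

End Dot.

(** * Stein inequality and exponential decay *)

Section Stein.
Context {R : realType}.

(** The strict decrease of the form [X] along [F] is a positive definite form,
    hence dominates a fixed fraction of the form [X]; this turns it into a
    uniform contraction. *)
Lemma stein_contraction n (X F : 'M[R]_n) : posdefmx X ->
  (forall v, v != 0 -> dot (F *m v) (X *m (F *m v)) < dot v (X *m v)) ->
  exists2 rho, 0 < rho < 1 &
    forall v, dot (F *m v) (X *m (F *m v)) <= rho * dot v (X *m v).
Proof.
move=> X0 FX; have XT : X^T = X by apply/symmetricmxP; case: X0.
have YE v : dot v ((X - F^T *m X *m F) *m v) =
    dot v (X *m v) - dot (F *m v) (X *m (F *m v)).
  by rewrite mulmxBl dotDr dotNr dot_mull !mulmxA.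
have Y0 : posdefmx (X - F^T *m X *m F).
  split.
    by apply/symmetricmxP; rewrite linearB /= !trmx_mul trmxK XT mulmxA.
  by move=> v v0; rewrite -mulmxA -/(dot v _) YE subr_gt0 FX.
have [c c0 cY] := posdefmx_coercive Y0; have [d d0 dX] := form_bound X.
exists (1 - Num.min 2^-1 (c / d)).
  (* The minimum with 1/2 keeps the factor positive, so that it has a
     logarithm. *)
  have m0 : 0 < Num.min 2^-1 (c / d).
    by rewrite lt_min; apply/andP; split; [lra|exact: divr_gt0].
  have m1 : Num.min 2^-1 (c / d) <= 2^-1 by rewrite ge_min lexx.
  by apply/andP; split; lra.
move=> v; have := cY v; rewrite YE mulrBl mul1r => Yv.
suff : Num.min 2^-1 (c / d) * dot v (X *m v) <= c * dot v v by lra.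
apply: (@le_trans _ _ (c / d * dot v (X *m v))).
  by apply: ler_wpM2r; [exact: posdefmx_ge0|rewrite ge_min lexx orbT].
by rewrite -mulrA ler_pM2l // ler_pdivrMl.
Qed.

(** A matrix and its transpose have the same gain: with [p = F^T v],
    [(p, p) = (v, F p)] and Cauchy-Schwarz bounds the square of the right-hand
    side by [(v, v) a (p, p)]. *)
Lemma trmx_gain n (F : 'M[R]_n) a :
  (forall v, dot (F *m v) (F *m v) <= a * dot v v) ->
  forall v, dot (F^T *m v) (F^T *m v) <= a * dot v v.
Proof.
move=> Fa v; set p := F^T *m v.
have [->|p0] := eqVneq p 0.
  by rewrite dot0l (le_trans (dot_ge0 (F *m v))).
have pE : dot p p = dot v (F *m p) by rewrite {1}/p dot_mull trmxK.
rewrite -(ler_pM2l (dot_gt0 p0)) -expr2 {1}pE.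
rewrite (le_trans (cauchy_schwarz _ _)) //.
rewrite [leRHS](_ : _ = dot v v * (a * dot p p)); last by ring.
by rewrite ler_wpM2l ?dot_ge0.
Qed.

Lemma exp_trmx n (F : 'M[R]_n) k : (F ^+ k)^T = F^T ^+ k.
Proof.
elim: k => [|k IH]; first by rewrite !expr0 trmx1.
by rewrite exprS exprSr -IH; exact: trmx_mul.
Qed.

(** The inequality [X - Phi X Phi^T > 0] makes [Phi^T] contract the form [X].
    The decay is transferred to the powers of [Phi] by equality of gains. *)
Lemma stein_decay n (X Phi : 'M[R]_n) : posdefmx X ->
  (forall v, v != 0 -> dot (Phi^T *m v) (X *m (Phi^T *m v)) < dot v (X *m v)) ->
  exists K rho, [/\ 0 < K, 0 < rho < 1 &
    forall k v, dot (Phi ^+ k *m v) (Phi ^+ k *m v) <= K * rho ^+ k * dot v v].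
Proof.
move=> X0 /(stein_contraction X0) [rho rho01 FX].
have [c c0 cX] := posdefmx_coercive X0; have [d d0 dX] := form_bound X.
exists (d / c), rho; split=> // [|k]; first exact: divr_gt0.
have rho0 : 0 <= rho by case/andP: rho01 => /ltW.
have step v : dot (Phi^T ^+ k *m v) (X *m (Phi^T ^+ k *m v)) <=
    rho ^+ k * dot v (X *m v).
  elim: k => [|k IH]; first by rewrite !expr0 !mul1mx mul1r.
  rewrite !exprS -mulmxA (le_trans (FX _)) // -mulrA.
  exact: ler_wpM2l.
rewrite -[Phi ^+ k]trmxK exp_trmx; apply: trmx_gain => v.
rewrite -!mulrA mulrCA ler_pdivlMl // (le_trans (cX _)) //.
rewrite (le_trans (step v)) //.
by rewrite mulrCA ler_wpM2l ?exprn_ge0.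
Qed.

Lemma enormE n (v : 'cV[R]_n) : enorm v = Num.sqrt (dot v v).
Proof. by rewrite /enorm dotE. Qed.

(** Decay along the multiples of [s] suffices: between two samples at most
    [s - 1] further steps are taken, each of bounded gain. *)
Lemma sampled_decay n (A : 'M[R]_n) s (K rho : R) : (0 < s)%N -> 0 < K ->
    0 < rho < 1 ->
    (forall k v, dot ((A ^+ s) ^+ k *m v) ((A ^+ s) ^+ k *m v) <=
      K * rho ^+ k * dot v v) ->
  exists K' gamma, [/\ 0 < K', 0 < gamma &
    forall t v, enorm (A ^+ t *m v) <= K' * expR (- gamma * t%:R) * enorm v].
Proof.
move=> s0 K0 /andP[rho0 rho1] decay.
have [c c1 Ac] := mulmx_bound A.
have c0 : 0 <= c by rewrite (le_trans ler01).
have Acr r v : dot (A ^+ r *m v) (A ^+ r *m v) <= c ^+ r * dot v v.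
  elim: r => [|r IH]; first by rewrite !expr0 mul1mx mul1r.
  by rewrite !exprS -mulmxA (le_trans (Ac _)) // -mulrA ler_wpM2l.
have sR : 0 < s%:R :> R by rewrite ltr0n.
(* [rho] is a factor per [s] steps of the squared norm, whence [2 * s]. *)
have [gamma gamma0 rhoE] : exists2 gamma, 0 < gamma &
    rho = expR (- (2 * gamma * s%:R)).
  exists (- ln rho / (2 * s%:R)).
    by rewrite divr_gt0 ?mulr_gt0 // oppr_gt0 ln_lt0 // rho0.
  rewrite -[LHS]lnK ?posrE //; congr expR.
  by field; rewrite pnatr_eq0 -lt0n.
(* The factor [expR (2 * gamma * s%:R)] pays for the incomplete last period. *)
have rhoX t : rho ^+ (t %/ s) <=
    expR (2 * gamma * s%:R) * expR (- gamma * t%:R) ^+ 2.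
  rewrite rhoE -[leLHS]expRM_natl -[_ ^+ 2]expRM_natl -[leRHS]expRD ler_expR.
  have : t%:R <= (t %/ s)%:R * s%:R + s%:R :> R.
    rewrite -natrM -natrD ler_nat {1}(divn_eq t s) leq_add2l.
    by rewrite ltnW // ltn_pmod.
  by move: gamma0; clear; nra.
pose L := c ^+ s * K * expR (2 * gamma * s%:R).
have L0 : 0 < L.
  by rewrite !mulr_gt0 ?expR_gt0 ?exprn_gt0 // (lt_le_trans ltr01).
exists (Num.sqrt L), gamma; split=> // [|t v]; first by rewrite sqrtr_gt0.
have sq : dot (A ^+ t *m v) (A ^+ t *m v) <=
    L * expR (- gamma * t%:R) ^+ 2 * dot v v.
  rewrite {1 2}(divn_eq t s) addnC mulnC exprD exprM -mulmxA.
  rewrite (le_trans (Acr _ _)) //.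
  apply: (@le_trans _ _ (c ^+ s * (K * rho ^+ (t %/ s) * dot v v))).
    apply: ler_pM; rewrite ?exprn_ge0 ?dot_ge0 //.
    by rewrite ler_weXn2l // ltnW // ltn_pmod.
  rewrite mulrA ler_wpM2r ?dot_ge0 // /L -2!mulrA.
  by rewrite ler_wpM2l ?exprn_ge0 // ler_wpM2l ?rhoX ?(ltW K0).
rewrite !enormE (le_trans (ler_wsqrtr sq)) //.
rewrite sqrtrM; last exact: mulr_ge0 (ltW L0) (sqr_ge0 _).
by rewrite sqrtrM ?(ltW L0) // sqrtr_sqr ger0_norm ?expR_ge0.
Qed.

End Stein.

(** * Stacked signals *)

Section Stack.
Context {R : realType}.

Lemma stackE k m (u : nat -> 'cV[R]_m) (i : 'I_k) (a : 'I_m) b :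
  stack k u (mxtens_index (i, a)) b = u i a 0.
Proof. by rewrite mxE mxtens_indexK. Qed.

Lemma eq_stack k m (u v : nat -> 'cV[R]_m) :
  (forall i, (i < k)%N -> u i = v i) -> stack k u = stack k v.
Proof. by move=> uv; apply/colP => i; rewrite !mxE uv. Qed.

(** A section of [stack k]: every vector of a lifted space is a stacked signal, so
    that identities between lifted matrices can be tested on signals. *)
Definition unstack k m (v : 'cV[R]_(k * m)) (i : nat) : 'cV[R]_m :=
  if insub i is Some i' then \col_a v (mxtens_index (i' : 'I_k, a)) 0 else 0.

Lemma unstackK k m (v : 'cV[R]_(k * m)) : stack k (unstack v) = v.
Proof.
apply/colP => l; case: (mxtens_indexP l) => i a.
by rewrite stackE /unstack valK mxE.
Qed.

Lemma stackD k m (u v : nat -> 'cV[R]_m) :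
  stack k u + stack k v = stack k (fun i => u i + v i).
Proof. by apply/colP => i; rewrite !mxE. Qed.

Lemma stackN k m (u : nat -> 'cV[R]_m) : - stack k u = stack k (fun i => - u i).
Proof. by apply/colP => i; rewrite !mxE. Qed.

Lemma sum_mxtens k m (F : 'I_(k * m) -> R) :
  \sum_l F l = \sum_(i < k) \sum_(a < m) F (mxtens_index (i, a)).
Proof.
rewrite pair_big /= (reindex (@mxtens_index k m)); last first.
  exists (@mxtens_unindex k m) => l _;
    by rewrite (mxtens_indexK, mxtens_unindexK).
by apply: eq_bigr => -[i a].
Qed.

Lemma dot_stack k m (u v : nat -> 'cV[R]_m) :
  dot (stack k u) (stack k v) = \sum_(i < k) dot (u i) (v i).
Proof.
rewrite dotE sum_mxtens; apply: eq_bigr => i _; rewrite dotE.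
by apply: eq_bigr => a _; rewrite !stackE.
Qed.

Lemma mulmx_stack p k m (B : nat -> 'M[R]_(p, m)) (u : nat -> 'cV[R]_m) :
  (\matrix_(i, l) B (mxtens_unindex l).1 i (mxtens_unindex l).2 :
    'M[R]_(p, k * m)) *m stack k u = \sum_(j < k) B j *m u j.
Proof.
apply/colP => i; rewrite mxE sum_mxtens summxE; apply: eq_bigr => j _.
by rewrite mxE; apply: eq_bigr => a _; rewrite stackE mxE mxtens_indexK.
Qed.

Lemma blockmx_stack k p m (D : nat -> nat -> 'M[R]_(p, m))
    (u : nat -> 'cV[R]_m) :
  (\matrix_(l, l') D (mxtens_unindex l).1 (mxtens_unindex l').1
      (mxtens_unindex l).2 (mxtens_unindex l').2 : 'M[R]_(k * p, k * m))
    *m stack k u = stack k (fun i => \sum_(j < k) D i j *m u j).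
Proof.
apply/colP => l; case: (mxtens_indexP l) => i b.
rewrite mxE sum_mxtens stackE summxE; apply: eq_bigr => j _.
by rewrite mxE; apply: eq_bigr => a _; rewrite stackE mxE !mxtens_indexK.
Qed.

Lemma tens1mx_stack k p m (D : 'M[R]_(p, m)) (u : nat -> 'cV[R]_m) :
  ((1%:M : 'M_k) *t D) *m stack k u = stack k (fun i => D *m u i).
Proof.
have -> : (1%:M : 'M_k) *t D = \matrix_(l, l')
    (((mxtens_unindex l).1 == (mxtens_unindex l').1 :> nat)%:R *: D)
      (mxtens_unindex l).2 (mxtens_unindex l').2.
  by apply/matrixP => l l'; rewrite !mxE.
rewrite (blockmx_stack k (fun i j => ((i == j :> nat)%:R *: D))).
apply: eq_stack => i ik; rewrite (bigD1 (Ordinal ik)) //= eqxx scale1r.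
rewrite big1 ?addr0 // => j /negPf ji; rewrite -val_eqE /= eq_sym in ji.
by rewrite ji scale0r mul0mx.
Qed.

Lemma block_index_inj m (i i' : nat) (a a' : 'I_m) :
  (i * m + a = i' * m + a')%N -> i = i' /\ a = a' :> nat.
Proof.
move=> e; have m0 : (0 < m)%N by rewrite (leq_ltn_trans _ (ltn_ord a)).
have := congr1 (divn^~ m) e; rewrite /= !divnMDl // !divn_small // !addn0 => ii.
by split=> //; move: e; rewrite ii => /addnI.
Qed.

(** The zero blocks meet the last [h - s] samples, so on stacked signals the
    padding is a truncation of the horizon. *)
Lemma pad_row_stack s h m p (sh : (s <= h)%N) (B : 'M[R]_(p, s * m))
    (u : nat -> 'cV[R]_m) :
  pad_row sh B *m stack h u = B *m stack s u.
Proof.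
rewrite /pad_row.
have -> : stack h u = castmx (stack_dimE m sh, erefl 1%N)
    (col_mx (stack s u) (stack (h - s) (fun i => u (s + i)%N))).
  apply/colP => l; case: (mxtens_indexP l) => i a.
  rewrite castmxE stackE /= cast_ord_id.
  case: (split_ordP (cast_ord (esym (stack_dimE m sh)) (mxtens_index (i, a))))
    => l' e; rewrite e; move/(congr1 val): e => /=.
    rewrite col_mxEu; case: (mxtens_indexP l') => i' a' /= e.
    by have [-> aa] := block_index_inj e; rewrite stackE (val_inj aa).
  rewrite col_mxEd; case: (mxtens_indexP l') => i' a' /=.
  rewrite addnA -mulnDl => e.
  by have [-> aa] := block_index_inj e; rewrite stackE (val_inj aa).
by rewrite mulmx_cast castmx_comp !castmx_id mul_row_col mul0mx addr0.
Qed.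

End Stack.

(** * Lifted equations of a linear system *)

Section Lifting.
Context {R : realType} {n p q : nat}.
Implicit Types (A : 'M[R]_n) (B : 'M[R]_(n, q)) (C : 'M[R]_(p, n))
  (D : 'M[R]_(p, q)) (u : nat -> 'cV[R]_q).

Definition forced_state A B u k : 'cV[R]_n :=
  \sum_(j < k) A ^+ (k - 1 - j) *m B *m u j.

(** The horizon does not occur, although the lifted matrices depend on it: this
    is causality, and it makes truncation of a lifted output immediate. *)
Definition forced_output A B C D u i : 'cV[R]_p :=
  C *m forced_state A B u i + D *m u i.

Lemma forced_stateS A B u k :
  forced_state A B u k.+1 = A *m forced_state A B u k + B *m u k.
Proof.
rewrite /forced_state big_ord_recr /= subn1 subnn expr0 mul1mx; congr (_ + _).
rewrite mulmx_sumr; apply: eq_bigr => j _; rewrite /= !mulmxA.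
have jk := ltn_ord j; have -> : (k - j = (k - 1 - j).+1)%N.
  by rewrite subnAC subn1 prednK // subn_gt0.
by rewrite exprS.
Qed.

Lemma lift_B_stack k A B u : lift_B k A B *m stack k u = forced_state A B u k.
Proof. exact: (mulmx_stack k (fun j => A ^+ (k - 1 - j) *m B)). Qed.

Lemma lift_C_mulmx k A C x :
  lift_C k A C *m x = stack k (fun i => C *m A ^+ i *m x).
Proof.
apply/colP => l; case: (mxtens_indexP l) => i b; rewrite stackE !mxE.
by apply: eq_bigr => j _; rewrite mxE mxtens_indexK.
Qed.

Lemma lift_D_stack k A B C D u :
  lift_D k A B C D *m stack k u = stack k (forced_output A B C D u).
Proof.
rewrite [LHS](blockmx_stack k (markov A B C D)); apply: eq_stack => i ik.
(* Block row [i] has Markov parameters left of the diagonal, the feedthrough on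
   it and zeros beyond. *)
rewrite (bigID (fun j : 'I_k => (j < i)%N)) /=; congr (_ + _).
  rewrite /forced_state mulmx_sumr.
  rewrite (big_ord_widen k
    (fun j => C *m (A ^+ (i - 1 - j) *m B *m u j)) (ltnW ik)).
  apply: eq_bigr => j ji; rewrite /markov gtn_eqF // ji !mulmxA.
  by rewrite (subnAC i 1).
rewrite (bigD1 (Ordinal ik)) /= ?ltnn //= /markov eqxx big1 ?addr0 // => j.
rewrite -leqNgt -val_eqE /= => /andP[ij /negPf ji].
by rewrite eq_sym ji ltnNge ij mul0mx.
Qed.

End Lifting.

Section Trajectory.
Context {R : realType} {n q r p : nat}.
Variables (A : 'M[R]_n) (B : 'M[R]_(n, q)) (E : 'M[R]_(n, r)).
Variables (C : 'M[R]_(p, n)) (D : 'M[R]_(p, q)) (F : 'M[R]_(p, r)).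
Variables (x : nat -> 'cV[R]_n) (w : nat -> 'cV[R]_q) (d : nat -> 'cV[R]_r)
  (o : nat -> 'cV[R]_p) (h : nat).
Hypothesis xS : forall k, (k < h)%N -> x k.+1 = A *m x k + B *m w k + E *m d k.
Hypothesis oE : forall k, (k < h)%N -> o k = C *m x k + D *m w k + F *m d k.

Lemma state_response k : (k <= h)%N ->
  x k = A ^+ k *m x 0%N + forced_state A B w k + forced_state A E d k.
Proof.
elim: k => [_|k IH kh].
  by rewrite expr0 mul1mx /forced_state !big_ord0 !addr0.
rewrite xS // IH ?(ltnW kh) // !forced_stateS exprS !mulmxDr mulmxA.
by rewrite -!addrA; congr (_ + _); rewrite !addrA; congr (_ + _); rewrite addrAC.
Qed.

Lemma state_lift : x h = A ^+ h *m x 0%N + lift_B h A B *m stack h w +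
  lift_B h A E *m stack h d.
Proof. by rewrite !lift_B_stack state_response. Qed.

Lemma output_lift : stack h o = lift_C h A C *m x 0%N +
  lift_D h A B C D *m stack h w + lift_D h A E C F *m stack h d.
Proof.
rewrite lift_C_mulmx !lift_D_stack !stackD; apply: eq_stack => k kh.
rewrite oE // (state_response (ltnW kh)) /forced_output !mulmxDr mulmxA.
by rewrite -!addrA; do 2 congr (_ + _); exact: addrCA.
Qed.

End Trajectory.

(** * The lifted inequality along the interconnection *)

Section Certificate.
Context {R : realType}.

Lemma dot_block_diag m n (X : 'M[R]_m) (Y : 'M[R]_n) u v :
  dot (col_mx u v) (block_diag X Y *m col_mx u v) =
    dot u (X *m u) + dot v (Y *m v).
Proof. by rewrite mul_block_col !mul0mx addr0 add0r dot_col_mx. Qed.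

(** The Kronecker products make the lifted form the sum of [s] copies of the
    form of the multiplier, each evaluated on the graph of [- D^T]. *)
Lemma lift_multiplier_le0 nz nw s (Q : 'M[R]_nz) (S : 'M[R]_(nz, nw))
    (T : 'M[R]_nw) (D : 'M[R]_(nw, nz)) (w : 'cV[R]_(s * nw)) :
  negsemidefmx ((col_mx (- D^T) 1%:M)^T *m block_mx Q S S^T T *m
    col_mx (- D^T) 1%:M) ->
  let v := col_mx (- ((1%:M : 'M_s) *t D)^T *m w) w in
  dot v (lift_multiplier s Q S T *m v) <= 0.
Proof.
move=> [_ nsd] /=; rewrite -(unstackK w); set u := unstack w.
rewrite trmx_tens trmx1 mulNmx tens1mx_stack stackN.
rewrite mul_block_col !tens1mx_stack !stackD dot_col_mx !dot_stack -big_split /=.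
apply: sumr_le0 => i _; have := nsd (u i).
rewrite -!mulmxA mulmxA -trmx_mul mul_col_mx mul1mx mulNmx mul_block_col.
by rewrite -/(dot _ _) dot_col_mx.
Qed.

End Certificate.

Section Loop.
Context {R : realType} {n nw nr nz ny : nat}.
Variable G : plant R n nw nr nz ny.

(** The row [W] paired with [(a, b)] is [(y - Cy x - Dyr r, b)] minus
    [(Cz x + Dzr r, a)] in lifted form. Along the trajectory these residuals are
    the responses to the unmeasured signal [w]: [Dyw w] and [z - Dzw w]. The
    kernel inclusion gives [M Dyw = (Bw 0)], which leaves only the first [s]
    samples of [w] and [z]. *)
Lemma data_annihilator (D : 'M[R]_(nw, nz)) h s (sh : (s <= h)%N) x w z r y
    (xi : 'cV[R]_n) (eta : 'cV[R]_(s * nz)) :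
  (forall k, (k < h)%N -> interconnection G D x w z r y k) ->
  (forall v : 'cV[R]_(h * nw),
       hatDyw G h *m v = 0 -> pad_row sh (hatBw G s) *m v = 0) ->
  (data_W G (x 0%N) (stack h r) (stack h y) *m
     col_mx ((mx_N sh)^T *m eta) ((mx_M G sh)^T *m xi)) 0 0 =
  dot xi (hatBw G s *m stack s w) -
  dot eta (stack s z - hatDzw G s *m stack s w).
Proof.
move=> traj ker.
have xS k : (k < h)%N -> x k.+1 = pA G *m x k + pBw G *m w k + pBr G *m r k.
  by move=> /traj[].
have zE : stack h z = hatCz G h *m x 0%N + hatDzw G h *m stack h w +
    hatDzr G h *m stack h r.
  by apply: output_lift => // k /traj[].
have yE : stack h y = hatCy G h *m x 0%N + hatDyw G h *m stack h w +
    hatDyr G h *m stack h r.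
  by apply: output_lift => // k /traj[].
(* [Dyw Dyw^+ Dyw = Dyw], so [Dyw^+ Dyw w - w] lies in the kernel of [Dyw]. *)
have MD : mx_M G sh *m (hatDyw G h *m stack h w) = hatBw G s *m stack s w.
  rewrite -(pad_row_stack sh) /mx_M -mulmxA; apply/eqP.
  rewrite -subr_eq0 -mulmxBr ker // mulmxBr; apply/eqP.
  by case: (mpinvP (hatDyw G h)) => DXD _ _ _; rewrite !mulmxA DXD subrr.
have ND : mx_N sh *m (stack h z - hatDzw G h *m stack h w) =
    stack s z - hatDzw G s *m stack s w.
  by rewrite !lift_D_stack !stackN !stackD /mx_N pad_row_stack mul1mx.
rewrite -MD -ND [dot xi _]dot_mulr [dot eta _]dot_mulr.
move: (_ *m xi) (_ *m eta) => b a.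
rewrite /data_W -mulmxA -/(dot _ _) !mul_col_mx !mul_row_col !dot_col_mx.
rewrite mul0mx add0r mul1mx !mulNmx !(dotDr, dotNr).
rewrite ![dot _ (_^T *m _)]dot_mulr !trmxK.
rewrite {1}yE zE !(dotDr, dotDl, dotNl, dotNr) !(dotC a) !(dotC b).
by ring.
Qed.

Definition closed_loop (D : 'M[R]_(nw, nz)) : 'M[R]_n :=
  pA G + pBw G *m D *m invmx (1%:M - pDzw G *m D) *m pCz G.

Lemma closed_loop_step D x w z y k : 1%:M - pDzw G *m D \in unitmx ->
  interconnection G D x w z (fun=> 0) y k -> x k.+1 = closed_loop D *m x k.
Proof.
move=> uD [-> zE _ wE]; rewrite mulmx0 addr0 /closed_loop mulmxDl; congr (_ + _).
have zx : z k = invmx (1%:M - pDzw G *m D) *m (pCz G *m x k).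
  apply: (canRL (mulKmx uD)); rewrite mulmxBl mul1mx {1}zE wE mulmx0 addr0.
  by rewrite -!mulmxA addrK.
by rewrite wE zx !mulmxA.
Qed.

(** Realizing the closed loop by signals lets the lifted equations be used
    instead of an inverse of the lifted loop matrix. *)
Lemma closed_loop_trajectory D x0 : 1%:M - pDzw G *m D \in unitmx ->
  exists w z y, forall k,
    interconnection G D (fun k => closed_loop D ^+ k *m x0) w z (fun=> 0) y k.
Proof.
move=> uD; pose x k := closed_loop D ^+ k *m x0.
pose z k := invmx (1%:M - pDzw G *m D) *m (pCz G *m x k).
pose w k := D *m z k.
exists w, z, (fun k => pCy G *m x k + pDyw G *m w k + pDyr G *m 0) => k.
split=> //; rewrite mulmx0 addr0.
  by rewrite exprS -mulmxA -/(x k) mulmxDl /w /z !mulmxA.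
have : (1%:M - pDzw G *m D) *m z k = pCz G *m x k by rewrite mulKVmx.
by rewrite mulmxBl mul1mx -mulmxA -/(w k) => <-; rewrite subrK.
Qed.

Section LiftedInequality.
Variables (D : 'M[R]_(nw, nz)) (h s : nat) (sh : (s <= h)%N).
Variables (x : nat -> 'cV[R]_n) (w : nat -> 'cV[R]_nw) (z : nat -> 'cV[R]_nz)
  (r : nat -> 'cV[R]_nr) (y : nat -> 'cV[R]_ny).
Hypothesis traj : forall k, (k < h)%N -> interconnection G D x w z r y k.
Hypothesis ker : forall v : 'cV[R]_(h * nw),
  hatDyw G h *m v = 0 -> pad_row sh (hatBw G s) *m v = 0.
Variables (X : 'M[R]_n) (Q : 'M[R]_nz) (S : 'M[R]_(nz, nw)) (T : 'M[R]_nw)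
  (PD : 'M[R]_(h * nz + h * ny)).
Hypothesis PDdata : data_multipliers G (x 0%N) (stack h r) (stack h y) PD.
Hypothesis QSTneg :
  negsemidefmx ((col_mx (- D^T) 1%:M)^T *m block_mx Q S S^T T *m
    col_mx (- D^T) 1%:M).
Hypothesis LMI : posdefmx ((outer_G G sh)^T *m
  block_diag X (block_diag (- X) (block_diag (lift_multiplier s Q S T) PD)) *m
  outer_G G sh).

Let Dhat : 'M[R]_(s * nw, s * nz) := (1%:M : 'M_s) *t D.

(** Evaluate the matrix inequality at [(xi, eta)]. The equation for [eta] puts
    [(eta, om)] on the graph of [- Dhat^T], where the multiplier term is
    nonpositive. It also makes the data term vanish, since the recorded signals
    satisfy [w = Dhat z]. Only the two terms in [X] remain. *)
Lemma lifted_stein_ineq (xi : 'cV[R]_n) (eta : 'cV[R]_(s * nz)) :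
  eta = Dhat^T *m ((hatBw G s)^T *m xi + (hatDzw G s)^T *m eta) ->
  col_mx xi eta != 0 ->
  let p := (pA G ^+ s)^T *m xi + (hatCz G s)^T *m eta in
  dot p (X *m p) < dot xi (X *m xi).
Proof.
move=> etaE v0 /=; set p := _ + _ *m eta.
pose om := - ((hatBw G s)^T *m xi + (hatDzw G s)^T *m eta).
have etaN : eta = - Dhat^T *m om by rewrite mulmxN mulNmx opprK.
pose a := (mx_N sh)^T *m eta; pose b := (mx_M G sh)^T *m xi.
have outerE : outer_G G sh *m col_mx xi eta =
    col_mx xi (col_mx (- p) (col_mx (col_mx eta om) (col_mx a b))).
  rewrite /outer_G !mul_col_mx !mul_row_col !mul0mx !mul1mx !addr0 !add0r.
  by rewrite !mulNmx -!opprD.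
have := posdefmx_gt0 LMI v0.
rewrite -!mulmxA dot_mulr trmxK outerE !dot_block_diag.
rewrite mulmxN mulNmx !(dotNl, dotNr) opprK.
have : dot (col_mx eta om) (lift_multiplier s Q S T *m col_mx eta om) <= 0.
  by rewrite {1 2}etaN; exact: lift_multiplier_le0.
suff -> : dot (col_mx a b) (PD *m col_mx a b) = 0 by lra.
have [q _ <-] := PDdata.
have W0 : data_W G (x 0%N) (stack h r) (stack h y) *m col_mx a b = 0.
  apply/matrixP => i j; rewrite !ord1 (data_annihilator xi eta traj ker) mxE.
  rewrite dotDr dotNr.
  have wE : stack s w = Dhat *m stack s z.
    rewrite tens1mx_stack; apply: eq_stack => i' i's.
    by case: (traj (leq_trans i's sh)).
  have -> : dot eta (stack s z) =
      dot ((hatBw G s)^T *m xi + (hatDzw G s)^T *m eta) (stack s w).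
    by rewrite {1}etaE wE dot_mulr.
  by rewrite dotDl !dot_mull !trmxK; ring.
by rewrite -scalemxAl -mulmxA W0 mulmx0 scaler0 dot0r.
Qed.

Hypothesis X0 : posdefmx X.

(** At [xi = 0] the remaining inequality reads [(p, X p) < 0]. *)
Lemma lifted_loop_injective (eta : 'cV[R]_(s * nz)) :
  eta = Dhat^T *m ((hatDzw G s)^T *m eta) -> eta = 0.
Proof.
move=> etaE; apply/eqP/negPn/negP => eta0.
have := @lifted_stein_ineq 0 eta; rewrite !mulmx0 !add0r dot0r.
have v0 : col_mx (0 : 'cV[R]_n) eta != 0.
  by apply: contra eta0 => /eqP; rewrite -col_mx0 => /eq_col_mx[_ ->].
by move=> /(_ etaE v0); rewrite /= ltNge posdefmx_ge0.
Qed.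

(** The lifted feedthrough is block lower triangular, so its transpose maps
    signals supported at time 0 to such signals and acts on them as the
    transposed feedthrough of the plant. A vector in the left kernel of
    [1 - Dzw D], placed at time 0, would contradict injectivity. *)
Lemma loop_unit : (0 < s)%N -> 1%:M - pDzw G *m D \in unitmx.
Proof.
move=> s0; rewrite -row_free_unit -kermx_eq0; apply/rowV0P => v /sub_kermxP vD.
have vE : v = v *m pDzw G *m D.
  by apply/eqP; rewrite -subr_eq0 -{1}[v]mulmx1 -mulmxA -mulmxBr vD.
pose e := stack s (fun i => if i == 0%N then v^T else 0).
have dot_e u : dot e (stack s u) = dot v^T (u 0%N).
  rewrite dot_stack (bigD1 (Ordinal s0)) //= big1 ?addr0 // => i.
  by rewrite -val_eqE /= => /negPf ->; rewrite dot0l.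
have e0 : e = 0.
  apply: lifted_loop_injective; apply: dot_inj => t; rewrite -(unstackK t).
  rewrite dot_mull trmxK dot_mull trmxK tens1mx_stack lift_D_stack !dot_e.
  rewrite /forced_output /forced_state big_ord0 mulmx0 add0r mulmxA.
  by rewrite [RHS]dot_mulr {1}vE !trmx_mul mulmxA.
have := dot_e (fun=> v^T); rewrite e0 dot0l => vv.
apply/eqP; rewrite -(inj_eq trmx_inj) trmx0; apply/negPn/negP => /dot_gt0.
by rewrite -vv ltxx.
Qed.

Lemma lifted_loop_solve (xi : 'cV[R]_n) : exists eta : 'cV[R]_(s * nz),
  eta = Dhat^T *m ((hatBw G s)^T *m xi + (hatDzw G s)^T *m eta).
Proof.
have u : 1%:M - Dhat^T *m (hatDzw G s)^T \in unitmx.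
  rewrite -unitmx_tr -row_free_unit -kermx_eq0.
  apply/rowV0P => v /sub_kermxP /(congr1 trmx); rewrite trmx_mul trmxK trmx0.
  rewrite mulmxBl mul1mx => /eqP; rewrite subr_eq0 => /eqP vE.
  by apply/trmx_inj; rewrite trmx0; apply: lifted_loop_injective; rewrite mulmxA.
exists (invmx (1%:M - Dhat^T *m (hatDzw G s)^T) *m
  (Dhat^T *m ((hatBw G s)^T *m xi))).
set eta := invmx _ *m _; rewrite mulmxDr; apply/eqP; rewrite -subr_eq.
have <- : (1%:M - Dhat^T *m (hatDzw G s)^T) *m eta =
    Dhat^T *m ((hatBw G s)^T *m xi).
  by rewrite mulKVmx.
by rewrite mulmxBl mul1mx mulmxA.
Qed.

(** For the [eta] attached to [xi], the vector [p] of the lifted inequality is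
    [(closed_loop ^+ s)^T xi]: against any initial state, [(xi, x s)] equals
    [(xi, A^s x0) + (xi, Bw w)], and the equation for [eta] turns [(xi, Bw w)]
    into [(eta, z - Dzw w) = (eta, Cz x0)]. *)
Lemma closed_loop_stein : (0 < s)%N -> forall xi : 'cV[R]_n, xi != 0 ->
  dot ((closed_loop D ^+ s)^T *m xi) (X *m ((closed_loop D ^+ s)^T *m xi)) <
  dot xi (X *m xi).
Proof.
move=> s0 xi xi0; have uD := loop_unit s0.
have [eta etaE] := lifted_loop_solve xi.
have v0 : col_mx xi eta != 0.
  by apply: contra xi0 => /eqP; rewrite -col_mx0 => /eq_col_mx[->].
have := lifted_stein_ineq etaE v0; set p := _ + _ *m eta.
suff -> : (closed_loop D ^+ s)^T *m xi = p by [].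
apply: dot_inj => x0; rewrite dot_mull trmxK.
have [w' [z' [y' cl]]] := closed_loop_trajectory x0 uD.
have st0 m : stack s (fun=> 0 : 'cV[R]_m) = 0 by apply/colP => i; rewrite !mxE.
set x' := (fun k => closed_loop D ^+ k *m x0) in cl.
have xS k : (k < s)%N -> x' k.+1 = pA G *m x' k + pBw G *m w' k + pBr G *m 0.
  by case: (cl k).
have x'0 : x' 0%N = x0 by rewrite /x' expr0 mul1mx.
have xE := state_lift xS; rewrite st0 mulmx0 addr0 x'0 in xE.
have zE : stack s z' = hatCz G s *m x0 + hatDzw G s *m stack s w'.
  rewrite -x'0 -[RHS]addr0 -(mulmx0 _ (hatDzr G s)) -(st0 nr).
  by apply: output_lift => // k _; case: (cl k).
have wE : stack s w' = Dhat *m stack s z'.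
  by rewrite tens1mx_stack; apply: eq_stack => i _; case: (cl i).
rewrite -[_ *m x0]/(x' s) xE -/(hatBw G s) /p dotDl dotDr.
rewrite !dot_mull !trmxK; congr (_ + _).
have -> : dot xi (hatBw G s *m stack s w') =
    dot eta (stack s z') - dot eta (hatDzw G s *m stack s w').
  by rewrite {1}etaE dot_mull trmxK -wE dotDl !dot_mull !trmxK addrK.
by rewrite zE dotDr addrK.
Qed.

End LiftedInequality.
End Loop.

Theorem theorem5 (R : realType) (n nw nr nz ny : nat)
    (G : plant R n nw nr nz ny)
    (Delta : set 'M[R]_(nw, nz)) (Dstar : 'M[R]_(nw, nz))
    (hDstar : Delta Dstar)
    (PP : set 'M[R]_(nz + nw)) (hPP : multiplier_set Delta PP)
    (h : nat) (hh : (1 <= h)%N)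
    (xs : 'cV[R]_n) (rs : 'cV[R]_(h * nr)) (ys : 'cV[R]_(h * ny))
    (hdata : io_trajectory G Dstar xs rs ys)
    (s : nat) (hs : (1 <= s)%N) (hsh : (s <= h)%N)
    (hker : forall v : 'cV[R]_(h * nw),
       hatDyw G h *m v = 0 -> pad_row hsh (hatBw G s) *m v = 0) :
  (exists (X : 'M[R]_n) (Q : 'M[R]_nz) (S : 'M[R]_(nz, nw)) (T : 'M[R]_nw)
          (PD : 'M[R]_(h * nz + h * ny)),
     [/\ posdefmx X,
         Q \is symmetricmx /\ T \is symmetricmx,
         PP (block_mx Q S S^T T),
         data_multipliers G xs rs ys PD &
         posdefmx
           ((outer_G G hsh)^T *m
            block_diag X (block_diag (- X)
              (block_diag (lift_multiplier s Q S T) PD)) *m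
            outer_G G hsh)]) ->
  stable G Dstar.
Proof.
move=> [X [Q [S [T [PD [X0 _ QSTP PDdata LMI]]]]]].
have [_ neg _] := hPP; have QSTneg := neg _ _ hDstar QSTP.
have [x [w [z [r [y [traj xE rE yE]]]]]] := hdata.
rewrite -xE -rE -yE in PDdata.
have uD := loop_unit traj hker PDdata QSTneg LMI X0 hs.
split=> //.
have [K [rho [K0 rho01 decay]]] :=
  stein_decay X0 (closed_loop_stein traj hker PDdata QSTneg LMI X0 hs).
have [K' [gamma [K'0 gamma0 bound]]] := sampled_decay hs K0 rho01 decay.
exists K', gamma; split=> // x' w' z' y' traj' t.
suff -> : x' t = closed_loop G Dstar ^+ t *m x' 0%N by exact: bound.
elim: t => [|t IH]; first by rewrite expr0 mul1mx.
by rewrite (closed_loop_step uD (traj' t)) IH exprS -mulmxA.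
Qed.
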